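(* Let $\Gamma=(X,R)$ be a bipartite distance-regular graph with diameter $D\ge 4$, valency $k\ge 3$ and eigenvalues $\theta_0>\theta_1>\cdots>\theta_D$. Put $d=\lfloor D/2\rfloor$, fix $x\in X$ and let $T=T(x)$. Choose $n\in\{1,d\}$ if $D$ is odd, and let $n=1$ if $D$ is even. Let $W$ be a thin irreducible $T$-module with endpoint $2$ and local eigenvalue $\tilde\theta_n=-1-\dfrac{b_2b_3}{\theta_n^2-b_2}$. Let $v$ be a nonzero vector in $E_2^*W$. Then the vectors $E_iv$ $(1\le i\le D-1,\ i\ne n,\ i\ne D-n)$ are mutually orthogonal and $$\|E_iv\|^2=\frac{m_i(\theta_i^2-k^2)(\theta_i^2-\theta_n^2)}{|X|\,k\,b_1(\theta_n^2-b_2)}\,\|v\|^2\qquad(1\le i\le D-1,\ i\ne n,\ i\ne D-n),$$ where $m_i$ denotes the multiplicity of $\theta_i$ (the denominator is nonzero).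
   Context: Graphs are finite, undirected, connected, without loops or multiple edges; $\partial$ denotes path-length distance. A graph $\Gamma=(X,R)$ of diameter $D$ is distance-regular if for all $0\le h,i,j\le D$ and all $x,y\in X$ with $\partial(x,y)=h$ the number $p^h_{ij}=|\{z\in X:\partial(x,z)=i,\ \partial(z,y)=j\}|$ depends only on $h,i,j$. Write $c_i=p^i_{1,i-1}$, $b_i=p^i_{1,i+1}$, $k=b_0$ (the valency). $\Gamma$ is bipartite if $X$ can be partitioned into two subsets neither of which contains an edge. For $0\le i\le D$, $A_i\in\mathrm{Mat}_X(\mathbb C)$ is the $i$th distance matrix: its $(y,z)$ entry is $1$ if $\partial(y,z)=i$ and $0$ otherwise; $A=A_1$ is the adjacency matrix. The distinct eigenvalues of $A$ are $\theta_0>\cdots>\theta_D$ (real); $E_i$ is the primitive idempotent of $\theta_i$, i.e. the orthogonal projection of $V=\mathbb C^X$ onto the $\theta_i$-eigenspace of $A$, and $m_i=\mathrm{rank}\,E_i$ is the multiplicity of $\theta_i$. $V$ carries the Hermitian inner product $\langle u,v\rangle=u^t\overline v$, $\|u\|^2=\langle u,u\rangle$. For bipartite $\Gamma$ with $D\ge4$, $\theta_1^2>b_2>\theta_d^2$. For fixed $x\in X$, $E_i^*=E_i^*(x)$ is the diagonal matrix in $\mathrm{Mat}_X(\mathbb C)$ with $(y,y)$ entry $1$ if $\partial(x,y)=i$ and $0$ otherwise. $T=T(x)$ is the subalgebra of $\mathrm{Mat}_X(\mathbb C)$ generated by $A,E_0^*,\ldots,E_D^*$. A $T$-module is a subspace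 $W\subseteq V$ with $BW\subseteq W$ for all $B\in T$; it is irreducible if it is nonzero and contains no $T$-modules other than $0$ and $W$. The endpoint of an irreducible $W$ is $\min\{i:E_i^*W\ne0\}$; $W$ is thin if $\dim E_i^*W\le1$ for $0\le i\le D$. If $W$ is thin irreducible with endpoint $2$, then $E_2^*W$ is a one-dimensional eigenspace for $E_2^*A_2E_2^*$; the corresponding eigenvalue is called the local eigenvalue of $W$. *)

(* Defs.v *)
From mathcomp Require Import all_boot all_order all_algebra.
From mathcomp Require Import complex reals.

Set Implicit Arguments.
Unset Strict Implicit.
Unset Printing Implicit Defensive.

Import GRing.Theory Num.Theory.
Local Open Scope ring_scope.
Local Open Scope complex_scope.

(* A graph is given by its adjacency relation [e] on a finite vertex set [X]. *)
Definition connected_graph {X : finType} (e : rel X) : Prop :=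
  [/\ symmetric e, irreflexive e & forall y z : X, connect e y z].

(* Least length of a walk from y to z (a path has fewer than #|X| edges; the
   junk value #|X| is returned when z is unreachable from y). *)
Definition dist {X : finType} (e : rel X) (y z : X) : nat :=
  find (fun l => [exists s : l.-tuple X, path e y s && (last y s == z)])
       (iota 0 #|X|).

Definition diameter {X : finType} (e : rel X) : nat :=
  \max_(yz : X * X) dist e yz.1 yz.2.

(* [p h i j] is the intersection number p^h_{ij}. *)
Definition distance_regular {X : finType} (e : rel X)
    (p : nat -> nat -> nat -> nat) : Prop :=
  forall (h i j : nat) (y z : X),
    (h <= diameter e)%N -> (i <= diameter e)%N -> (j <= diameter e)%N ->
    dist e y z = h ->
    #|[set w | (dist e y w == i) && (dist e w z == j)]| = p h i j.

Definition bnum (p : nat -> nat -> nat -> nat) (i : nat) : nat := p i 1%N i.+1.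

Definition bipartite {X : finType} (e : rel X) : Prop :=
  exists Y : {set X}, forall y z : X, e y z ->
    ~~ ((y \in Y) && (z \in Y)) /\ ~~ ((y \in ~: Y) && (z \in ~: Y)).

(* Mat_X(C) is rendered as ['M[R[i]]_#|X|] and V = C^X as column vectors, the
   vertex set being indexed through [enum_val]. *)
Definition distance_mx (R : realType) {X : finType} (e : rel X) (i : nat) :
    'M[R[i]]_#|X| :=
  \matrix_(y, z) (dist e (enum_val y) (enum_val z) == i)%:R.

Definition dual_idempotent (R : realType) {X : finType} (e : rel X) (x : X)
    (i : nat) : 'M[R[i]]_#|X| :=
  diag_mx (\row_y (dist e x (enum_val y) == i)%:R).

(* The operator u |-> B u on column vectors. *)
Definition mxop {R : realType} {n : nat} (B : 'M[R[i]]_n) :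
    'End('cV[R[i]]_n) := linfun (mulmx B).

(* <u, v> = u^t conj(v), so that <u, u> is the squared norm of u. *)
Definition hdot {R : realType} {n : nat} (u v : 'cV[R[i]]_n) : R[i] :=
  (u^T *m map_mx (@conjc R) v) 0 0.

(* theta 0 > ... > theta D are exactly the distinct eigenvalues of B. *)
Definition ordered_eigenvalues {R : realType} {n : nat} (B : 'M[R[i]]_n)
    (D : nat) (theta : nat -> R) : Prop :=
  (forall i j : nat, (i < j)%N -> (j <= D)%N -> theta j < theta i) /\
  (forall a : R[i], passmx.leigenvalue (mxop B) a <->
     exists2 i : nat, (i <= D)%N & a = (theta i)%:C).

Definition orthogonal_projection {R : realType} {n : nat} (P : 'M[R[i]]_n)
    (U : {vspace 'cV[R[i]]_n}) : Prop :=
  forall u : 'cV[R[i]]_n,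
    P *m u \in U /\ forall w, w \in U -> hdot (u - P *m u) w = 0.

(* Membership in the subalgebra T(x) generated by A and the E_i^*. *)
Inductive terwilliger (R : realType) {X : finType} (e : rel X) (x : X) :
    'M[R[i]]_#|X| -> Prop :=
  | terwilliger_adj : terwilliger e x (distance_mx R e 1)
  | terwilliger_dual i : (i <= diameter e)%N ->
      terwilliger e x (dual_idempotent R e x i)
  | terwilliger_one : terwilliger e x 1%:M
  | terwilliger_add B C :
      terwilliger e x B -> terwilliger e x C -> terwilliger e x (B + C)
  | terwilliger_scale a B : terwilliger e x B -> terwilliger e x (a *: B)
  | terwilliger_mul B C :
      terwilliger e x B -> terwilliger e x C -> terwilliger e x (B *m C).

Definition Tmodule {R : realType} {X : finType} (e : rel X) (x : X)
    (W : {vspace 'cV[R[i]]_#|X|}) : Prop :=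
  forall B, terwilliger e x B -> (mxop B @: W <= W)%VS.

Definition irreducible_Tmodule {R : realType} {X : finType} (e : rel X) (x : X)
    (W : {vspace 'cV[R[i]]_#|X|}) : Prop :=
  [/\ Tmodule e x W, W <> 0%VS &
      forall U, Tmodule e x U -> (U <= W)%VS -> U = 0%VS \/ U = W].

Definition dual_part {R : realType} {X : finType} (e : rel X) (x : X) (i : nat)
    (W : {vspace 'cV[R[i]]_#|X|}) : {vspace 'cV[R[i]]_#|X|} :=
  (mxop (dual_idempotent R e x i) @: W)%VS.

Definition has_endpoint {R : realType} {X : finType} (e : rel X) (x : X)
    (W : {vspace 'cV[R[i]]_#|X|}) (r : nat) : Prop :=
  dual_part e x r W <> 0%VS /\
  forall i : nat, (i < r)%N -> dual_part e x i W = 0%VS.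

Definition thin {R : realType} {X : finType} (e : rel X) (x : X)
    (W : {vspace 'cV[R[i]]_#|X|}) : Prop :=
  forall i : nat, (i <= diameter e)%N -> (\dim (dual_part e x i W) <= 1)%N.

(* Meant for W thin irreducible with endpoint 2, where E_2^* W is a line. *)
Definition local_eigenvalue {R : realType} {X : finType} (e : rel X) (x : X)
    (W : {vspace 'cV[R[i]]_#|X|}) (eta : R[i]) : Prop :=
  let E2 := dual_idempotent R e x 2 in
  (dual_part e x 2 W <=
     passmx.leigenspace (mxop (E2 *m distance_mx R e 2 *m E2)) eta)%VS.

(* Main.v *)
Require Import Defs.
From mathcomp Require Import all_boot all_order all_algebra.
From mathcomp Require Import complex reals.
From mathcomp Require Import spectral ring lra zify.

Set Implicit Arguments.
Unset Strict Implicit.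
Unset Printing Implicit Defensive.

Import Order.TTheory GRing.Theory Num.Theory.
Local Open Scope ring_scope.
Local Open Scope complex_scope.

(** Why the theorem holds.  Orthogonality is immediate, because the vectors
    E_i v lie in eigenspaces of the real symmetric matrix A for distinct real
    eigenvalues.  For the norms, write E for E_i and t for theta_i.

    E is a polynomial in A, and multiplication by A preserves the matrices
    whose entries depend only on the distance between the two indices
    ([mul_adjacency_distance]).  Hence E has entries q(dist(y,z))
    ([eigenprojection_class_constant]).  Comparing entries in A E = t E gives a
    three-term recurrence for q, and the trace gives q(0) = m_i / |X|
    ([eigenprojection_recurrence]).

    The vector v is supported on the sphere of radius 2 around x, where two
    vertices are at distance 0, 2 or 4 by bipartiteness.  On this sphere the
    distance-0 matrix acts on v as 1 and the distance-2 matrix as the local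
    eigenvalue eta.  The entries of v sum to 0: A^2 v belongs to W, so its entry
    at x vanishes, and that entry is c_2 times the sum ([endpoint_sum_eq0]).
    So the distance-4 matrix acts as -(1 + eta), and on the sphere E v equals
    lambda v with lambda = q(0) + eta q(2) - (1 + eta) q(4)
    ([class_constant_mul_endpoint]).  As E is an orthogonal projection,
    |E v|^2 = <v, E v> = lambda |v|^2, and the recurrence turns lambda into the
    stated quotient ([cosine_combination]).

    The denominator is nonzero because theta_n^2 <> b_2
    ([square_theta_neq_b2]).  Counting closed walks of lengths 2 and 4 shows
    that (k^2 - A^2)(A^2 - b_2) has trace 0.  The spectrum is symmetric about 0,
    so theta_1^2 is the largest and, for odd D, theta_d^2 the smallest of the
    squared eigenvalues other than k^2.  If b_2 were either one, all terms of the
    trace would have the same sign, hence vanish, and theta_1, theta_2, theta_3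
    would be three distinct numbers with the same square. *)

(** * Distance in a connected graph *)

Lemma dist_le_size (X : finType) (e : rel X) (y : X) (s : seq X) :
  path e y s -> (dist e y (last y s) <= size s)%N.
Proof.
move=> es; rewrite /dist; set P := (fun l : nat => _).
case: (ltnP (size s) #|X|) => [ltsX | leXs]; last first.
  by apply: leq_trans leXs; rewrite -[leqRHS](size_iota 0) find_size.
rewrite leqNgt; apply/negP => /(before_find 0%N); rewrite nth_iota // add0n.
by move/negbT/negP; apply; apply/existsP; exists (in_tuple s); rewrite es eqxx.
Qed.

Section Distance.
Variables (X : finType) (e : rel X).
Hypothesis Ge : connected_graph e.

Lemma geodesic (y z : X) :
  exists2 s, path e y s & last y s = z /\ size s = dist e y z.
Proof.
have [_ _ /(_ y z) /connectP [s0 es0 ->]] := Ge.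
case/shortenP: es0 => s es us _.
rewrite /dist; set P := (fun l : nat => _).
have hasP : has P (iota 0 #|X|).
  apply/hasP; exists (size s); last first.
    by apply/existsP; exists (in_tuple s); rewrite es eqxx.
  rewrite mem_iota add0n -[(_ < _)%N]/(size (y :: s) <= _)%N.
  by rewrite -(card_uniqP us) max_card.
have := nth_find 0%N hasP; rewrite nth_iota ?add0n; last first.
  by rewrite -[ltnRHS](size_iota 0) -has_find.
case/existsP => t /andP [et /eqP lt].
by exists (tval t) => //; rewrite size_tuple.
Qed.

Lemma distC (y z : X) : dist e y z = dist e z y.
Proof.
have [esym _ _] := Ge.
suff le u w : (dist e u w <= dist e w u)%N by apply/eqP; rewrite eqn_leq !le.
have [s es [<- <-]] := geodesic w u.
have -> : size s = size (rev (belast w s)) by rewrite size_rev size_belast.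
have {2}-> : w = last (last w s) (rev (belast w s)).
  by case: s es => //= a s _; rewrite rev_cons last_rcons.
by apply: dist_le_size; rewrite rev_path; under eq_path do rewrite esym.
Qed.

Lemma dist_triangle (y w z : X) :
  (dist e y z <= dist e y w + dist e w z)%N.
Proof.
have [s es [ls <-]] := geodesic y w; have [t et [lt <-]] := geodesic w z.
have <- : last y (s ++ t) = z by rewrite last_cat ls.
by rewrite -size_cat dist_le_size // cat_path es ls.
Qed.

Lemma dist_eq0 (y z : X) : (dist e y z == 0%N) = (y == z).
Proof.
apply/eqP/eqP => [d0|<-]; last first.
  by apply/eqP; rewrite -leqn0 (dist_le_size (s := [::])).
by have [s _ [ls]] := geodesic y z; rewrite d0 -ls => /size0nil ->.
Qed.

Lemma dist_eq1 (y z : X) : (dist e y z == 1%N) = e y z.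
Proof.
have [_ eirr _] := Ge.
apply/eqP/idP => [d1|eyz].
  have [s + [ls]] := geodesic y z; rewrite d1 -ls.
  by case: s {ls} => [|w [|w' s]] //= /andP[].
apply/eqP; rewrite eqn_leq (dist_le_size (s := [:: z])) /= ?eyz //.
by rewrite lt0n dist_eq0; apply: contraTneq eyz => ->; rewrite eirr.
Qed.

(** The second vertex of a geodesic. *)
Lemma dist_closer_neighbor (y z : X) (h : nat) :
  dist e y z = h.+1 -> exists2 w, e y w & dist e w z = h.
Proof.
have [s es [ls sz]] := geodesic y z; rewrite -sz.
case: s es ls sz => //= w s /andP[eyw es] ls sz [<-]; exists w => //.
have /eqP d1 := etrans (dist_eq1 y w) eyw.
have := dist_le_size es; have := dist_triangle y w z.
rewrite ls -sz d1 /=; lia.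
Qed.

Lemma dist_le_diameter (y z : X) : (dist e y z <= diameter e)%N.
Proof. exact: (leq_bigmax (y, z)). Qed.

(** Walking along a geodesic between two vertices at distance D meets every
    smaller distance; this realises each intersection number by an actual pair
    of vertices. *)
Lemma dist_attained (h : nat) :
  (0 < diameter e)%N -> (h <= diameter e)%N -> exists y z, dist e y z = h.
Proof.
move=> D_gt0; have [y [z ->]] : exists y z, diameter e = dist e y z.
  have [|X0] := posnP #|{: X * X}|.
    move=> X0; move: D_gt0; rewrite /diameter big_pred0 // => u.
    by have := card0_eq X0 u.
  by have [u eq_u] := bigop.eq_bigmax (fun yz => dist e yz.1 yz.2) X0; exists u.1, u.2.
move=> le_h; rewrite -(subKn le_h); move: (_ - h)%N (leq_subr h (dist e y z)).
elim=> [|l IH] le_l; first by exists y, z; rewrite subn0.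
have [y' [z' d']] := IH (ltnW le_l).
have [|w _ dw] := @dist_closer_neighbor y' z' (dist e y z - l.+1)%N.
  by rewrite d'; lia.
by exists w, z'.
Qed.

Hypothesis Be : bipartite e.

Lemma bipartite_colouring : exists Y : pred X, forall y z, e y z -> Y z = ~~ Y y.
Proof.
have [Y eY] := Be; exists (fun y => y \in Y) => y z /eY; rewrite !inE.
by case: (y \in Y); case: (z \in Y) => -[].
Qed.

(** The colour changes at each step of a geodesic. *)
Lemma odd_dist : exists Y : pred X, forall y z, odd (dist e y z) = Y y (+) Y z.
Proof.
have [Y eY] := bipartite_colouring; exists Y => y z.
have [s es [<- <-]] := geodesic y z.
elim: s y es => [|a s IH] y /=; first by rewrite addbb.
by case/andP=> /eY ea /IH ->; rewrite ea addNb negbK.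
Qed.

(** Distances to z change by at most 1 along an edge, and by parity they do
    change. *)
Lemma dist_neighbor (y w z : X) : e y w ->
  dist e w z = (dist e y z).+1 \/ dist e y z = (dist e w z).+1.
Proof.
have [esym _ _] := Ge; move=> eyw.
have [Y oddY] := odd_dist.
have /eqP d1 := etrans (dist_eq1 y w) eyw.
have := oddY y w; rewrite d1 /=; have := oddY w z; have := oddY y z.
have /eqP d1' := etrans (dist_eq1 w y) (etrans (esym w y) eyw).
have := dist_triangle y w z; have := dist_triangle w y z.
rewrite d1 d1'; case: (Y y) (Y w) (Y z) => [] [] [] //=; lia.
Qed.

End Distance.

(** * Adjacency acting on functions of the distance *)

Section NeighborSums.
Variables (X : finType) (e : rel X) (p : nat -> nat -> nat -> nat).
Hypotheses (Ge : connected_graph e) (Re : distance_regular e p).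
Hypotheses (Be : bipartite e) (D_gt0 : (0 < diameter e)%N).

Lemma card_neighbors (y : X) : #|[set w | e y w]| = bnum p 0.
Proof.
have y0 : dist e y y = 0%N by apply/eqP; rewrite dist_eq0.
rewrite /bnum -(Re (leq0n _) D_gt0 D_gt0 y0); apply: eq_card => w.
by rewrite !inE (distC Ge w y) dist_eq1 // andbb.
Qed.

Lemma card_farther_neighbors (y z : X) (h : nat) :
  (h < diameter e)%N -> dist e y z = h ->
  #|[set w | e y w && (dist e w z == h.+1)]| = bnum p h.
Proof.
move=> ltD dh; rewrite /bnum -(Re (ltnW ltD) D_gt0 ltD dh); apply: eq_card => w.
by rewrite !inE dist_eq1.
Qed.

(** The number b_h, with b_D = 0: the entry of p at indices beyond the diameter
    is arbitrary. *)
Definition up (h : nat) : nat := if (h < diameter e)%N then bnum p h else 0.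

(** In a bipartite graph a_h = 0, so c_h = k - b_h.  The value of [q] at the
    predecessor of 0 is harmless, since c_0 = 0. *)
Definition neighbor_step {V : nmodType} (q : nat -> V) (h : nat) : V :=
  q h.-1 *+ (bnum p 0 - up h) + q h.+1 *+ up h.

Lemma sum_neighbors (V : nmodType) (q : nat -> V) (y z : X) :
  \sum_(w | e y w) q (dist e w z) = neighbor_step q (dist e y z).
Proof.
set h := dist e y z.
have cup : #|[set w | e y w && (dist e w z == h.+1)]| = up h.
  rewrite /up; case: ltnP => [ltD|geD]; first exact: card_farther_neighbors.
  apply: eq_card0 => w; rewrite !inE; apply/negP => /andP[_ /eqP dw].
  by have := dist_le_diameter e w z; rewrite dw; lia.
rewrite (bigID (fun w => dist e w z == h.+1)) /= addrC /neighbor_step.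
congr (_ + _).
  rewrite (eq_bigr (fun=> q h.-1)); last first.
    move=> w /andP[eyw /eqP ne]; congr q.
    by case: (dist_neighbor Ge Be z eyw) => // dw; rewrite /h dw.
  rewrite sumr_const -(card_neighbors y) -cup; congr (_ *+ _).
  rewrite -(cardsID [set w | dist e w z == h.+1] [set w | e y w]).
  have -> : [set w | e y w && (dist e w z == h.+1)] =
      [set w | e y w] :&: [set w | dist e w z == h.+1].
    by apply/setP => w; rewrite !inE.
  by rewrite addKn; apply: eq_card => w; rewrite !inE andbC.
rewrite (eq_bigr (fun=> q h.+1)); last by move=> w /andP[_ /eqP ->].
rewrite sumr_const -cup; congr (_ *+ _).
by apply: eq_card => w; rewrite !inE.
Qed.

Lemma up_le (h : nat) : (h <= diameter e)%N -> (up h <= bnum p 0)%N.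
Proof.
rewrite /up; case: ltnP => // ltD _.
have [y [z dh]] := dist_attained Ge D_gt0 (ltnW ltD).
rewrite -(card_farther_neighbors ltD dh) -(card_neighbors y) subset_leq_card //.
by apply/subsetP => w; rewrite !inE => /andP[].
Qed.

Lemma up0 : up 0 = bnum p 0.
Proof. by rewrite /up D_gt0. Qed.

(** If y and z are adjacent, then by parity every neighbour of y except z is at
    distance 2 from z. *)
Lemma up1 : (1 < diameter e)%N -> up 1 = (bnum p 0).-1.
Proof.
move=> D_gt1; rewrite /up D_gt1; have [y [z d1]] := dist_attained Ge D_gt0 D_gt0.
have eyz : e y z by rewrite -(dist_eq1 Ge) d1.
rewrite -(card_farther_neighbors D_gt1 d1) -(card_neighbors y).
rewrite (cardsD1 z [set w | e y w]) inE eyz /=; apply: eq_card => w.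
rewrite !inE andbC; case: (boolP (e y w)) => eyw; rewrite ?andbF // !andbT.
rewrite -(dist_eq0 Ge w z).
by case: (dist_neighbor Ge Be z eyw); rewrite d1; lia.
Qed.

Lemma up_lt (h : nat) : (0 < h <= diameter e)%N -> (up h < bnum p 0)%N.
Proof.
case: h => // h /= le_hD; rewrite /up.
have [y [z dh]] := dist_attained Ge D_gt0 le_hD.
have [w eyw dw] := dist_closer_neighbor Ge dh.
rewrite -(card_neighbors y).
case: (ltnP h.+1 _) => [ltD|_]; last by apply/card_gt0P; exists w; rewrite inE.
rewrite -(card_farther_neighbors ltD dh); apply: proper_card; apply/properP; split.
  by apply/subsetP => u; rewrite !inE => /andP[].
exists w; rewrite !inE eyw // dw; lia.
Qed.

Variable R : realType.
Notation A := (distance_mx R e 1).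
Notation d a b := (dist e (enum_val a) (enum_val b)).

Lemma adjacency_row_sum (f : X -> R[i]) (a : 'I_#|X|) :
  \sum_b A a b * f (enum_val b) = \sum_(w | e (enum_val a) w) f w.
Proof.
rewrite [RHS]big_mkcond (reindex _ (onW_bij _ (enum_val_bij X))) /=.
apply: eq_bigr => b _; rewrite mxE dist_eq1 //.
by case: ifP; rewrite ?mul1r ?mul0r.
Qed.

Lemma mul_adjacency_distance (q : nat -> R[i]) (M : 'M[R[i]]_#|X|) :
  (forall a b, M a b = q (d a b)) ->
  forall a b, (A *m M) a b = neighbor_step q (d a b).
Proof.
move=> Mq a b; rewrite mxE -sum_neighbors.
rewrite -(adjacency_row_sum (fun w => q (dist e w (enum_val b)))).
by apply: eq_bigr => c _; rewrite Mq.
Qed.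

End NeighborSums.

(** * Hermitian geometry and spectral decomposition *)

Section LinearAlgebra.
Variables (R : realType) (n : nat).
Implicit Types (u v w : 'cV[R[i]]_n) (B P Q : 'M[R[i]]_n).

Lemma hdotE u v : hdot u v = \sum_a u a 0 * (v a 0)^*%C.
Proof. by rewrite /hdot mxE; apply: eq_bigr => a _; rewrite !mxE. Qed.

Lemma hdotBl u v w : hdot (u - v) w = hdot u w - hdot v w.
Proof. by rewrite /hdot linearB mulmxBl !mxE. Qed.

Lemma hdotZl a u w : hdot (a *: u) w = a * hdot u w.
Proof. by rewrite /hdot linearZ -scalemxAl mxE. Qed.

Lemma hdotZr a u w : hdot u (a *: w) = a^*%C * hdot u w.
Proof. by rewrite /hdot map_mxZ -scalemxAr mxE. Qed.

Lemma hdot_eq0 u : hdot u u = 0 -> u = 0.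
Proof.
rewrite hdotE => /eqP.
rewrite psumr_eq0 => [/allP u0|a _]; last exact: mul_conjC_ge0.
apply/matrixP => a b; rewrite (ord1 b) mxE.
have := u0 a (mem_index_enum a).
by rewrite (mul_conjC_eq0 (u a 0)) => /eqP.
Qed.

Lemma conjc_real (a : R) : (a%:C)^*%C = a%:C.
Proof. by rewrite /= oppr0. Qed.

Definition real_symmetric B := B^T = B /\ map_mx (@conjc R) B = B.

Lemma hdot_symmetric B u w :
  real_symmetric B -> hdot (B *m u) w = hdot u (B *m w).
Proof. by case=> symB realB; rewrite /hdot trmx_mul symB map_mxM realB mulmxA. Qed.

Lemma mem_eigenspace B a u :
  (u \in passmx.leigenspace (mxop B) a) = (B *m u == a *: u).
Proof.
rewrite memv_ker add_lfunE opp_lfunE scale_lfunE id_lfunE /mxop lfunE /=.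
by rewrite subr_eq0.
Qed.

Lemma eigenvalueP B a :
  passmx.leigenvalue (mxop B) a <-> exists2 u : 'cV[R[i]]_n, u != 0 & B *m u = a *: u.
Proof.
split=> [Ba|[u nzu Bu]].
  exists (vpick (passmx.leigenspace (mxop B) a)); first by rewrite vpick0.
  by apply/eqP; rewrite -mem_eigenspace memv_pick.
apply: contraNneq nzu => Ba.
by rewrite -memv0 -Ba mem_eigenspace Bu.
Qed.

Lemma orthogonal_eigenvectors B (a b : R) u w : real_symmetric B -> a != b ->
  B *m u = a%:C *: u -> B *m w = b%:C *: w -> hdot u w = 0.
Proof.
move=> symB neq Bu Bw; have := hdot_symmetric u w symB.
rewrite Bu Bw hdotZl hdotZr conjc_real => /eqP; rewrite -subr_eq0 -mulrBl mulf_eq0.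
by rewrite subr_eq0 (inj_eq (@complexI R)) (negPf neq) => /eqP.
Qed.

Lemma eq_mulmx_cV B P : (forall u, B *m u = P *m u) -> B = P.
Proof.
move=> eqBP; apply/matrixP => a b.
have /matrixP /(_ a 0) := eqBP (delta_mx b 0).
by rewrite -!colE !mxE.
Qed.

Lemma orthogonal_projection_uniq P Q U :
  orthogonal_projection P U -> orthogonal_projection Q U -> P = Q.
Proof.
move=> hP hQ; apply: eq_mulmx_cV => u; apply/eqP; rewrite -subr_eq0; apply/eqP.
have [UP oP] := hP u; have [UQ oQ] := hQ u.
have UPQ : P *m u - Q *m u \in U by rewrite rpredB.
apply: hdot_eq0; set w := _ - _ in UPQ *.
have {1}-> : w = (u - Q *m u) - (u - P *m u).
  by rewrite /w opprB [RHS]addrC addrA subrK.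
by rewrite hdotBl oP ?oQ ?subrr.
Qed.

Lemma orthogonal_projection_id P U w :
  orthogonal_projection P U -> w \in U -> P *m w = w.
Proof.
move=> hP Uw; have [UP oP] := hP w; apply/esym/eqP; rewrite -subr_eq0; apply/eqP.
by apply: hdot_eq0; apply: oP; rewrite rpredB.
Qed.

(** In a full-rank factorisation P = L M, idempotence forces M L = 1, and
    tr (L M) = tr (M L). *)
Lemma mxtrace_idempotent P : P *m P = P -> \tr P = (\rank P)%:R.
Proof.
move=> idP.
have [B] := row_fullP (col_base_full P).
have [C] := row_freeP (row_base_free P).
move: (col_base P) (row_base P) (mulmx_base P) => L M PE MC BL.
have ML : M *m L = 1%:M.
  have : L *m M *m (L *m M) = L *m M by rewrite PE.
  move/(congr1 (fun N => B *m N *m C)) => /=.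
  by rewrite !mulmxA BL !mul1mx -mulmxA MC mulmx1.
by rewrite -[P in \tr P]PE mxtrace_mulC ML mxtrace1.
Qed.

Lemma real_symmetric_diagonalization B : real_symmetric B ->
  exists2 P, P \in unitmx & exists d : 'rV_n, B = invmx P *m diag_mx d *m P.
Proof.
case=> symB realB; exists (spectralmx B); first exact: spectral_unit.
exists (spectral_diag B); apply/orthomx_spectralP/normalmxP.
by rewrite symB [map_mx _ _]realB.
Qed.

Section Annihilator.
Variables (B P : 'M[R[i]]_n) (d : 'rV[R[i]]_n).
Hypotheses (uP : P \in unitmx) (BE : B = invmx P *m diag_mx d *m P).

Lemma diagonal_is_eigenvalue j : passmx.leigenvalue (mxop B) (d 0 j).
Proof.
apply/eigenvalueP; exists (invmx P *m delta_mx j 0).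
  apply: contraTneq isT => /(congr1 (mulmx P)); rewrite mulKVmx // mulmx0.
  by move/matrixP/(_ j 0)/eqP; rewrite !mxE !eqxx oner_eq0.
rewrite BE -!mulmxA mulKVmx // scalemxAr; congr (_ *m _).
apply/matrixP => a b; rewrite mul_diag_mx !mxE.
by have [->|_] := eqVneq a j; rewrite ?mulr0.
Qed.

Lemma eigenvalue_is_diagonal a :
  passmx.leigenvalue (mxop B) a -> exists j, d 0 j = a.
Proof.
case/eigenvalueP => u nzu Bu; have nzPu : P *m u != 0.
  by apply: contraNneq nzu => Pu; rewrite -(mulKmx uP u) Pu mulmx0.
have [j nzj] : exists j, (P *m u) j 0 != 0.
  by have /matrix0Pn [j [b]] := nzPu; rewrite (ord1 b); exists j.
exists j; have /(congr1 (mulmx P)) := Bu.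
rewrite BE -!mulmxA mulKVmx // -scalemxAr mul_diag_mx => /matrixP/(_ j 0).
by rewrite [LHS]mxE [RHS]mxE => /(mulIf nzj).
Qed.

(** The value at B of the monic polynomial with roots s; taken over all but one
    of the eigenvalues it is a multiple of a primitive idempotent. *)
Definition shift_product (s : seq R) : 'M[R[i]]_n :=
  \big[mulmx/1%:M]_(t <- s) (B - (t%:C)%:M).

Lemma shift_product_cons t s :
  shift_product (t :: s) = (B - (t%:C)%:M) *m shift_product s.
Proof. exact: big_cons. Qed.

Lemma shift_product_diagonal s :
  shift_product s =
    invmx P *m diag_mx (\row_j \prod_(t <- s) (d 0 j - t%:C)) *m P.
Proof.
elim: s => [|t s IH].
  rewrite /shift_product big_nil.
  have -> : \row_j \prod_(t <- [::]) (d 0 j - t%:C) = const_mx 1 :> 'rV[R[i]]_n.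
    by apply/rowP => j; rewrite !mxE big_nil.
  by rewrite diag_const_mx mulmx1 mulVmx.
rewrite shift_product_cons IH.
have -> : B - (t%:C)%:M = invmx P *m diag_mx (d - const_mx t%:C) *m P.
  rewrite linearB /= diag_const_mx mulmxBr mulmxBl -BE.
  by rewrite -mulmxA mul_scalar_mx -scalemxAr mulVmx // scalemx1.
rewrite -!mulmxA mulKVmx // [in LHS](mulmxA (diag_mx _)) mulmx_diag.
congr (_ *m (diag_mx _ *m _)); apply/rowP => j.
by rewrite !mxE big_cons.
Qed.

Lemma shift_product_eq0 s :
  (forall j, exists2 t, t \in s & d 0 j = t%:C) -> shift_product s = 0.
Proof.
move=> ds; rewrite shift_product_diagonal.
suff -> : \row_j \prod_(t <- s) (d 0 j - t%:C) = 0 :> 'rV[R[i]]_n.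
  by rewrite linear0 mulmx0 mul0mx.
apply/rowP => j; rewrite !mxE; have [t st ->] := ds j.
by apply/eqP; rewrite prodf_seq_eq0; apply/hasP; exists t; rewrite ?subrr ?eqxx.
Qed.

Lemma mxtrace_diagonalized : \tr B = \sum_j d 0 j.
Proof. by rewrite BE -mulmxA mxtrace_mulC -mulmxA mulmxV // mulmx1 mxtrace_diag. Qed.

Lemma square_diagonalized :
  B *m B = invmx P *m diag_mx (\row_j d 0 j ^+ 2) *m P.
Proof.
rewrite [in LHS]BE -!mulmxA mulKVmx // [in LHS](mulmxA (diag_mx _)) mulmx_diag.
by congr (_ *m (diag_mx _ *m _)); apply/rowP => j; rewrite !mxE expr2.
Qed.

End Annihilator.

End LinearAlgebra.

(** * The spectrum of a bipartite distance-regular graph *)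

(** The sequence i |-> - theta (D - i) is decreasing with the same values, and
    a set has only one decreasing enumeration. *)
Lemma decreasing_symmetric (R : numDomainType) (D : nat) (theta : nat -> R) :
  (forall i j, (i < j)%N -> (j <= D)%N -> theta j < theta i) ->
  (forall i, (i <= D)%N -> exists2 j, (j <= D)%N & theta j = - theta i) ->
  forall i, (i <= D)%N -> theta (D - i)%N = - theta i.
Proof.
move=> decr opp; pose s := mkseq (fun i => - theta (D - i)%N) D.+1.
suff eq_s : mkseq theta D.+1 = s.
  move=> i le_i; have := congr1 (fun t => nth 0 t (D - i)) eq_s.
  by rewrite !nth_mkseq ?ltnS ?leq_subr // subKn.
apply: (@irr_sorted_eq _ (fun a b => b < a)).
- by move=> a b c ba ac; exact: lt_trans ac ba.
- by move=> a; rewrite ltxx.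
- apply/(sortedP 0) => i; rewrite size_mkseq => lt_i.
  by rewrite !nth_mkseq ?(ltnW lt_i) ?decr.
- apply/(sortedP 0) => i; rewrite size_mkseq => lt_i.
  rewrite !nth_mkseq ?(ltnW lt_i) // ltrN2 decr ?leq_subr //; lia.
move=> a; apply/mapP/mapP; case=> i; rewrite mem_iota add0n ltnS => le_i ->.
  have [j le_j tj] := opp i le_i; exists (D - j)%N.
    by rewrite mem_iota add0n ltnS leq_subr.
  by rewrite subKn // tj opprK.
have [j le_j tj] := opp (D - i)%N (leq_subr _ _).
by exists j; rewrite ?mem_iota ?add0n ?ltnS.
Qed.

Section Spectrum.
Variables (R : realType) (X : finType) (e : rel X) (p : nat -> nat -> nat -> nat).
Hypotheses (Ge : connected_graph e) (Re : distance_regular e p).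
Hypotheses (Be : bipartite e) (D_ge4 : (4 <= diameter e)%N).

Notation A := (distance_mx R e 1).
Notation C := R[i].
Notation D := (diameter e).
Notation k := (bnum p 0).
Notation d a b := (dist e (enum_val a) (enum_val b)).

Let D_gt0 : (0 < D)%N. Proof. exact: leq_trans D_ge4. Qed.

Lemma adjacency_real_symmetric : real_symmetric A.
Proof.
split; apply/matrixP => a b; rewrite !mxE; first by rewrite distC.
exact: rmorph_nat.
Qed.

Lemma mul_adjacency_col (u : 'cV[R[i]]_#|X|) a :
  (A *m u) a 0 = \sum_(w | e (enum_val a) w) u (enum_rank w) 0.
Proof.
rewrite mxE -(adjacency_row_sum Ge (fun w => u (enum_rank w) 0)).
by apply: eq_bigr => b _; rewrite enum_valK.
Qed.

Lemma valency_eigenvalue : passmx.leigenvalue (mxop A) (k%:R%:C).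
Proof.
have [y _] := dist_attained Ge D_gt0 (leq0n _).
apply/eigenvalueP; exists (const_mx 1).
  apply/eqP => /matrixP /(_ (enum_rank y) 0); rewrite !mxE.
  by move/eqP; rewrite oner_eq0.
apply/matrixP => a b; rewrite (ord1 b) mul_adjacency_col !mxE mulr1.
rewrite (eq_bigr (fun=> 1)) => [|w _]; last by rewrite mxE.
rewrite sumr_const -(card_neighbors Ge Re D_gt0 (enum_val a)) rmorph_nat.
by congr (_ *+ _); apply: eq_card => w; rewrite inE.
Qed.

(** Changing the sign of an eigenvector on one colour class negates the
    eigenvalue. *)
Lemma opp_eigenvalue a :
  passmx.leigenvalue (mxop A) a -> passmx.leigenvalue (mxop A) (- a).
Proof.
have [Y eY] := bipartite_colouring Be.
case/eigenvalueP => u nzu Au; apply/eigenvalueP.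
exists (\col_b ((-1) ^+ Y (enum_val b) * u b 0)).
  apply: contraNneq nzu => /matrixP u0; apply/eqP/matrixP => b c.
  rewrite (ord1 c) mxE; have /eqP := u0 b 0; rewrite !mxE.
  by rewrite mulrI_eq0 => [/eqP //|]; apply: lregX; apply: lregN; apply: lreg1.
apply/matrixP => b c; rewrite (ord1 c) mul_adjacency_col !mxE.
rewrite (eq_bigr (fun w => - (-1) ^+ Y (enum_val b) * u (enum_rank w) 0)).
  rewrite -mulr_sumr -mul_adjacency_col Au mxE; ring.
by move=> w ebw; rewrite mxE enum_rankK (eY _ _ ebw) signrN.
Qed.

(** Summing |a| |u_y| <= sum of |u_w| over the neighbours w of y, over all y,
    counts each |u_w| exactly k times on the right. *)
Lemma eigenvalue_le_valency (a : R) :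
  passmx.leigenvalue (mxop A) a%:C -> `|a| <= k%:R.
Proof.
have [esym _ _] := Ge.
case/eigenvalueP => u nzu Au; pose g w : R[i] := `|u (enum_rank w) 0|.
have g_ge0 w : 0 <= g w by exact: normr_ge0.
have g_gt0 : 0 < \sum_w g w.
  rewrite lt0r sumr_ge0 // andbT psumr_eq0 // -has_predC.
  have /matrix0Pn [b [c nz]] := nzu; apply/hasP; exists (enum_val b).
    exact: mem_index_enum.
  by rewrite /= normr_eq0 enum_valK -(ord1 c).
have le_g : `|a%:C| * \sum_w g w <= k%:R * \sum_w g w.
  rewrite !mulr_sumr; apply: (@le_trans _ _ (\sum_y \sum_(w | e y w) g w)).
    apply: ler_sum => y _; rewrite -normrM.
    have /matrixP/(_ (enum_rank y) 0) := Au; rewrite mul_adjacency_col !mxE => <-.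
    by rewrite enum_rankK ler_norm_sum.
  rewrite (exchange_big_dep predT) //=; apply: ler_sum => w _.
  rewrite sumr_const -(card_neighbors Ge Re D_gt0 w) mulr_natl.
  by rewrite (eq_card (B := [set y | e w y])) // => y; rewrite inE unfold_in esym.
move: le_g; rewrite ler_pM2r // -lecR; congr (_ <= _); last by rewrite rmorph_nat.
by rewrite normc_def /= expr0n addr0 sqrtr_sqr.
Qed.

(** Walks of length 2 and 4, with c_2 = k - b_2 and b_1 = k - 1: the closed ones
    number k and (k + b_1 c_2) k, and c_2 walks of length 2 join two vertices at
    distance 2. *)
Lemma walk_counts (delta0 := fun h => (h == 0%N)%:R : C) :
  [/\ neighbor_step e p (neighbor_step e p delta0) 0 = k%:R,
      neighbor_step e p (neighbor_step e p delta0) 2 = k%:R - (bnum p 2)%:R &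
      neighbor_step e p (neighbor_step e p
        (neighbor_step e p (neighbor_step e p delta0))) 0
        = (k%:R + (k%:R - (bnum p 2)%:R) * (k%:R - 1)) * k%:R].
Proof.
have u0 := up0 p D_gt0.
have u1 := up1 Ge Re Be D_gt0 (leq_trans (isT : 1 < 4)%N D_ge4).
have u2 : up e p 2 = bnum p 2 by rewrite /up (leq_trans _ D_ge4).
have lt_u2k : (up e p 2 < k)%N.
  by apply: (up_lt (h := 2) Ge Re D_gt0); exact: leq_trans _ D_ge4.
have k_gt0 : (0 < k)%N := leq_ltn_trans (leq0n _) lt_u2k.
have at0 (q : nat -> C) : neighbor_step e p q 0 = q 1%N *+ k.
  by rewrite /neighbor_step u0 subnn mulr0n add0r.
have at1 (q : nat -> C) : neighbor_step e p q 1 = q 0%N + q 2%N *+ k.-1.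
  by rewrite /neighbor_step u1 -{1}(prednK k_gt0) subSnn mulr1n.
have at2 (q : nat -> C) :
    neighbor_step e p q 2 = q 1%N *+ (k - bnum p 2) + q 3%N *+ bnum p 2.
  by rewrite /neighbor_step u2.
rewrite !(at0, at1, at2) /neighbor_step /delta0 /= !mul0rn !addr0 !mul0rn !addr0.
have kb2 : (k - bnum p 2)%N%:R = k%:R - (bnum p 2)%:R :> C.
  by rewrite natrB // -u2 ltnW.
rewrite kb2; split=> //.
by rewrite mulr_natr -(mulr_natr _ k.-1) -subn1 natrB.
Qed.

Lemma trace_of_class_constant (q : nat -> C) (M : 'M[C]_#|X|) :
  (forall a b, M a b = q (d a b)) -> \tr M = #|X|%:R * q 0%N.
Proof.
move=> Mq; rewrite /mxtrace (eq_bigr (fun=> q 0%N)) => [|a _].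
  by rewrite sumr_const card_ord mulr_natl.
by rewrite Mq; congr q; apply/eqP; rewrite dist_eq0.
Qed.

Variable theta : nat -> R.
Hypothesis eig : ordered_eigenvalues A D theta.

Lemma theta_eigenvalue i : (i <= D)%N -> passmx.leigenvalue (mxop A) (theta i)%:C.
Proof. by move=> le_i; apply/(eig.2 _); exists i. Qed.

Lemma theta_opp i : (i <= D)%N -> theta (D - i)%N = - theta i.
Proof.
apply: decreasing_symmetric; first exact: eig.1.
move=> j /theta_eigenvalue /opp_eigenvalue /(eig.2 _) [l le_l tl].
by exists l => //; apply: complexI; rewrite -tl rmorphN.
Qed.

Lemma theta_anti i j : (i <= j <= D)%N -> theta j <= theta i.
Proof.
case/andP; rewrite leq_eqVlt => /orP[/eqP->//|lt_ij le_j].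
exact/ltW/eig.1.
Qed.

Lemma theta0 : theta 0 = k%:R.
Proof.
have [i le_i ki] := (eig.2 _).1 valency_eigenvalue.
have := eigenvalue_le_valency (theta_eigenvalue (leq0n D)).
have := theta_anti (i := 0) le_i; rewrite -(complexI ki).
by move=> le1 /(le_trans (ler_norm _)) le2; apply: le_anti; rewrite le2.
Qed.

(** The trace of (k^2 - A^2)(A^2 - b_2) is 0.  The diagonal entries of a
    diagonalization are recorded as [theta (r j)], so that each eigenvalue is
    counted with its multiplicity. *)
Lemma sum_spectrum_eq0 : exists2 r : 'I_#|X| -> nat,
  (forall j, (r j <= D)%N) /\
  (forall i, (i <= D)%N -> exists j, r j = i) &
  \sum_j (k%:R ^+ 2 - theta (r j) ^+ 2) * (theta (r j) ^+ 2 - (bnum p 2)%:R) = 0.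
Proof.
have [P uP [dg AE]] := real_symmetric_diagonalization adjacency_real_symmetric.
have /fin_all_exists [r rP] : forall j, exists i, (i <= D)%N /\ dg 0 j = (theta i)%:C.
  move=> j; have /(eig.2 _) [i le_i ->] := diagonal_is_eigenvalue uP AE j.
  by exists i.
exists r; first split=> [j|i le_i]; first by case: (rP j).
  have [j tj] := eigenvalue_is_diagonal uP AE (theta_eigenvalue le_i).
  exists j; have [le_r tr] := rP j; have eq_t : theta (r j) = theta i.
    by apply: complexI; rewrite -tr.
  case: (ltngtP (r j) i) => // lt; have := eig.1 _ _ lt.
    by rewrite eq_t ltxx => /(_ le_i).
  by rewrite eq_t ltxx => /(_ le_r).
apply: complexI; rewrite rmorph_sum rmorph0 /=.
(* Both traces are |X| times the number of closed walks at a vertex. *)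
have traces : \tr (A *m A) = #|X|%:R * k%:R /\
    \tr ((A *m A) *m (A *m A)) =
      #|X|%:R * ((k%:R + (k%:R - (bnum p 2)%:R) * (k%:R - 1)) * k%:R).
  pose delta0 h : C := (h == 0%N)%:R.
  have one a b : (1%:M : 'M[C]_#|X|) a b = delta0 (d a b).
    by rewrite mxE /delta0 dist_eq0 // (inj_eq enum_val_inj).
  have A1 := @mul_adjacency_distance X e p Ge Re Be D_gt0 R.
  have [<- _ <-] := walk_counts; have A2 := A1 _ _ (A1 _ _ one).
  split; first by rewrite -(trace_of_class_constant A2) mulmx1.
  rewrite -(trace_of_class_constant (A1 _ _ (A1 _ _ A2))).
  by rewrite mulmx1 !mulmxA.
have := traces; have sqE := square_diagonalized uP AE.
rewrite (mxtrace_diagonalized uP (square_diagonalized uP sqE)).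
rewrite (mxtrace_diagonalized uP sqE) => -[tr2 tr4].
transitivity ((k%:R ^+ 2 + (bnum p 2)%:R) * (\sum_j dg 0 j ^+ 2)
  - \sum_j (dg 0 j ^+ 2) ^+ 2 - \sum_(j < #|X|) (k%:R ^+ 2 * (bnum p 2)%:R) : C).
  rewrite mulr_sumr -!sumrB; apply: eq_bigr => j _.
  have [_ ->] := rP j.
  rewrite !(rmorphM, rmorphB, rmorphXn, rmorph_nat) /=; ring.
have -> : \sum_j dg 0 j ^+ 2 = #|X|%:R * k%:R.
  by rewrite -tr2; apply: eq_bigr => j _; rewrite mxE.
have -> : \sum_j (dg 0 j ^+ 2) ^+ 2 =
    #|X|%:R * ((k%:R + (k%:R - (bnum p 2)%:R) * (k%:R - 1)) * k%:R).
  by rewrite -tr4; apply: eq_bigr => j _; rewrite !mxE.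
rewrite sumr_const card_ord -(mulr_natl _ #|X|); ring.
Qed.

Lemma theta_bounds i : (0 < i < D)%N -> - k%:R < theta i < k%:R.
Proof.
case/andP=> i_gt0 lt_i; rewrite -theta0 eig.1 ?(ltnW lt_i) // andbT.
by rewrite -(theta_opp (leq0n D)) subn0 eig.1.
Qed.

(** By [sum_spectrum_eq0], b_2 cannot be an extreme value among the squares of
    the eigenvalues other than k and -k: otherwise all these squares would
    coincide, whereas there are at least three such eigenvalues. *)
Lemma square_theta_neq_b2 n :
  n = 1%N \/ odd D /\ n = D./2 -> theta n ^+ 2 != (bnum p 2)%:R.
Proof.
move=> n_or; apply/eqP => eq_b.
pose F i := (k%:R ^+ 2 - theta i ^+ 2) * (theta i ^+ 2 - theta n ^+ 2).
have gap_ge0 i : (i <= D)%N -> 0 <= k%:R ^+ 2 - theta i ^+ 2.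
  move=> le_i; rewrite subr_ge0 -real_normK ?num_real // lerXn2r ?nnegrE //.
  exact/eigenvalue_le_valency/theta_eigenvalue.
(* The sign s is -1 when theta_n^2 is the largest of the squares and 1 when it
   is the smallest. *)
have [s s_neq0 F_ge0] : exists2 s : R, s != 0 &
    forall i, (i <= D)%N -> 0 <= s * F i.
  case: n_or => [n1|[oddD nd]].
    exists (-1) => [|i le_i]; first by rewrite oppr_eq0 oner_eq0.
    have [i_ends|lt_i] : (i = 0%N \/ i = D) \/ (0 < i < D)%N by lia.
      have -> : F i = 0.
        rewrite /F; case: i_ends => ->; last rewrite -(subn0 D) theta_opp // sqrrN.
          by rewrite theta0 subrr mul0r.
        by rewrite theta0 subrr mul0r.
      by rewrite mulr0.
    have le1 : theta i <= theta 1 by apply: theta_anti; lia.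
    have leN1 : - theta 1 <= theta i.
      by rewrite -theta_opp //; apply: theta_anti; lia.
    rewrite mulN1r /F -mulrN opprB mulr_ge0 ?gap_ge0 // n1; nra.
  exists 1 => [|i le_i]; first exact: oner_neq0.
  have leD : (n <= D)%N by lia.
  have DnE : (D - n)%N = n.+1 by lia.
  have t_gt0 : 0 < theta n.
    have := eig.1 n n.+1 (ltnSn n); rewrite -DnE theta_opp // => /(_ (leq_subr _ _)).
    lra.
  rewrite mul1r mulr_ge0 ?gap_ge0 //.
  have [le_in|lt_ni] := leqP i n.
    have : theta n <= theta i by apply: theta_anti; lia.
    nra.
  have : theta i <= - theta n by rewrite -theta_opp //; apply: theta_anti; lia.
  nra.
have [r [le_r r_onto] sumF] := sum_spectrum_eq0.
have F0 i : (i <= D)%N -> F i = 0.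
  case/r_onto => j <-; apply/eqP; rewrite -(mulrI_eq0 (F (r j)) (lregP s_neq0)).
  apply/eqP; move: (j) (erefl true); apply: psumr_eq0P => [l _|].
    exact: F_ge0.
  by rewrite -mulr_sumr /F eq_b sumF mulr0.
have sq i : (0 < i < D)%N -> theta i ^+ 2 = theta n ^+ 2.
  move=> lt_i; have := theta_bounds lt_i; have := F0 i; rewrite /F.
  case/andP: (lt_i) => _ lt_iD => /(_ (ltnW lt_iD)) /eqP.
  rewrite mulf_eq0 subr_sqr mulf_eq0 subr_eq0 addr_eq0 subr_eq0.
  case/orP => [/orP[]|] /eqP // -> /andP[]; rewrite ?ltxx //.
  by rewrite opprK ltxx.
have t12 : theta 2 < theta 1 by apply: eig.1; lia.
have t23 : theta 3 < theta 2 by apply: eig.1; lia.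
have sq1 : theta 1 ^+ 2 = theta n ^+ 2 by apply: sq; lia.
have sq2 : theta 2 ^+ 2 = theta n ^+ 2 by apply: sq; lia.
have sq3 : theta 3 ^+ 2 = theta n ^+ 2 by apply: sq; lia.
have e12 : theta 1 = - theta 2.
  have /eqP := etrans sq1 (esym sq2); rewrite eqf_sqr => /orP[/eqP eq|/eqP //].
  by rewrite eq ltxx in t12.
have /eqP := etrans sq3 (esym sq2); rewrite eqf_sqr => /orP[] /eqP eq.
  by rewrite eq ltxx in t23.
by have := lt_trans t23 t12; rewrite eq -e12 ltxx.
Qed.

(** Up to the factor c, the product of the A - theta_j over j <> i is the
    projection P.  Its range lies in the eigenspace, because the product over
    all eigenvalues is 0.  Its factors are self-adjoint and act as scalars on a
    vector w of the eigenspace, so <Q u, w> = c <u, w> for the product Q, and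
    u - Q u / c is orthogonal to w.  A product of shifts of A has entries
    depending only on the distance. *)
Lemma eigenprojection_class_constant i P : (i <= D)%N ->
  orthogonal_projection P (passmx.leigenspace (mxop A) (theta i)%:C) ->
  exists q : nat -> C, forall a b, P a b = q (d a b).
Proof.
move=> le_i hP; have symA := adjacency_real_symmetric.
have [T uT [dg AE]] := real_symmetric_diagonalization symA.
pose s := [seq theta j | j <- iota 0 D.+1 & j != i].
pose c := \prod_(t <- s) (theta i - t).
have c_neq0 : c != 0.
  rewrite prodf_seq_neq0; apply/allP => _ /mapP [j + ->]; rewrite mem_filter mem_iota.
  case/andP=> neq_ji /=; rewrite ltnS => le_j; rewrite subr_eq0.
  case: (ltngtP i j) neq_ji => // lt _.
    by rewrite gt_eqF // eig.1.
  by rewrite lt_eqF // eig.1.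
pose Q := shift_product A s.
have hQ : orthogonal_projection (c^-1%:C *: Q)
    (passmx.leigenspace (mxop A) (theta i)%:C).
  move=> u; split.
    rewrite mem_eigenspace -scalemxAl -scalemxAr scalerA [_ * c^-1%:C]mulrC -scalerA.
    apply/eqP; congr (_ *: _); apply/eqP.
    rewrite -subr_eq0 -mul_scalar_mx -mulmxBl mulmxA -shift_product_cons.
    rewrite (shift_product_eq0 uT AE) ?mul0mx // => j.
    have /(eig.2 _) [l le_l ->] := diagonal_is_eigenvalue uT AE j.
    exists (theta l) => //; rewrite inE; have [->|neq_li] := eqVneq l i.
      by rewrite eqxx.
    by apply/orP; right; apply: map_f; rewrite mem_filter neq_li mem_iota.
  move=> w; rewrite mem_eigenspace => /eqP Aw.
  rewrite hdotBl -scalemxAl hdotZl.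
  suff -> : hdot (Q *m u) w = c%:C * hdot u w.
    by rewrite mulrA -rmorphM mulVf // mul1r subrr.
  rewrite /Q /c; elim: (s) => [|t s' IH].
    by rewrite /shift_product !big_nil mul1mx mul1r.
  rewrite shift_product_cons big_cons -mulmxA mulmxBl mul_scalar_mx hdotBl hdotZl.
  rewrite (hdot_symmetric _ _ symA) Aw hdotZr conjc_real IH rmorphM rmorphB /=; ring.
rewrite (orthogonal_projection_uniq hP hQ).
suff [q Qq] : exists q, forall a b, Q a b = q (d a b).
  by exists (fun h => c^-1%:C * q h) => a b; rewrite mxE Qq.
rewrite /Q; elim: (s) => [|t s' [q IH]].
  exists (fun h => (h == 0%N)%:R) => a b.
  by rewrite /shift_product big_nil mxE dist_eq0 // (inj_eq enum_val_inj).
exists (fun h => neighbor_step e p q h - t%:C * q h) => a b.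
rewrite shift_product_cons mulmxBl mul_scalar_mx !mxE -IH.
by rewrite -(mul_adjacency_distance Ge Re Be D_gt0 IH) mxE.
Qed.

Lemma eigenprojection_recurrence i P (q : nat -> C) : (i <= D)%N ->
  orthogonal_projection P (passmx.leigenspace (mxop A) (theta i)%:C) ->
  (forall a b, P a b = q (d a b)) ->
  [/\ #|X|%:R * q 0%N = (\rank P)%:R,
      (theta i)%:C * q 0%N = k%:R * q 1%N,
      (theta i)%:C * q 1%N = q 0%N + (k%:R - 1) * q 2%N,
      (theta i)%:C * q 2%N =
        (k%:R - (bnum p 2)%:R) * q 1%N + (bnum p 2)%:R * q 3%N &
      (theta i)%:C * q 3%N =
        (k%:R - (bnum p 3)%:R) * q 2%N + (bnum p 3)%:R * q 4%N].
Proof.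
move=> le_i hP Pq.
have PP : P *m P = P.
  apply: eq_mulmx_cV => u; rewrite -mulmxA.
  by rewrite (orthogonal_projection_id hP) //; case: (hP u).
have AP : A *m P = (theta i)%:C *: P.
  apply: eq_mulmx_cV => u; rewrite -mulmxA -scalemxAl; apply/eqP.
  by rewrite -mem_eigenspace; case: (hP u).
have rec h : (h <= D)%N -> (theta i)%:C * q h = neighbor_step e p q h.
  move=> le_h; have [y [z dh]] := dist_attained Ge D_gt0 le_h.
  have := mul_adjacency_distance Ge Re Be D_gt0 Pq (enum_rank y) (enum_rank z).
  by rewrite AP mxE Pq !enum_rankK dh.
have k_gt0 := leq_ltn_trans (leq0n _) (up_lt (h := 1) Ge Re D_gt0 D_gt0).
have le_up h : (h <= D)%N -> (up e p h <= k)%N by exact: up_le.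
have u2 : up e p 2 = bnum p 2 by rewrite /up (leq_trans _ D_ge4).
have u3 : up e p 3 = bnum p 3 by rewrite /up (leq_trans _ D_ge4).
split.
- by rewrite -(trace_of_class_constant Pq) mxtrace_idempotent.
- by rewrite rec // /neighbor_step (up0 p D_gt0) subnn mulr0n add0r mulr_natl.
- rewrite rec // /neighbor_step (up1 Ge Re Be D_gt0) ?(leq_trans _ D_ge4) //.
  rewrite -{1}(prednK k_gt0) subSnn mulr1n.
  by rewrite -(subn1 k) -(mulr_natl _ (_ - _)%N) natrB.
- rewrite rec ?(leq_trans _ D_ge4) // /neighbor_step.
  rewrite -(mulr_natl _ (_ - _)%N) -(mulr_natl _ (up _ _ _)).
  by rewrite natrB ?u2 // -u2 le_up ?(leq_trans _ D_ge4).
- rewrite rec ?(leq_trans _ D_ge4) // /neighbor_step.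
  rewrite -(mulr_natl _ (_ - _)%N) -(mulr_natl _ (up _ _ _)).
  by rewrite natrB ?u3 // -u3 le_up ?(leq_trans _ D_ge4).
Qed.

End Spectrum.

(** With u = k (k - 1), the recurrence gives u (q0 - q2) = (k^2 - t^2) q0 and
    u b2 b3 (q2 - q4) = (k^2 - t^2) (t^2 - b2) q0, and the left-hand side is
    q0 - q2 + (1 + eta) (q2 - q4). *)
Lemma cosine_combination (F : fieldType) (k b2 b3 t s q0 q1 q2 q3 q4 : F) :
  k != 0 -> k - 1 != 0 -> s - b2 != 0 ->
  t * q0 = k * q1 -> t * q1 = q0 + (k - 1) * q2 ->
  t * q2 = (k - b2) * q1 + b2 * q3 -> t * q3 = (k - b3) * q2 + b3 * q4 ->
  let eta := - 1 - b2 * b3 / (s - b2) in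
  q0 + eta * q2 - (1 + eta) * q4 =
    q0 * (t ^+ 2 - k ^+ 2) * (t ^+ 2 - s) / (k * (k - 1) * (s - b2)).
Proof.
move=> k0 k1 s0 r0 r1 r2 r3 /=.
have e1 : q1 = t * q0 / k by rewrite r0; field.
have e2 : q2 = (t * q1 - q0) / (k - 1) by rewrite r1; field.
(* Only b2 q3 and b2 b3 q4 are solved for: b2 and b3 may be zero here. *)
have e3 : b2 * q3 = t * q2 - (k - b2) * q1 by rewrite r2; ring.
have e4 : b2 * (b3 * q4) = t * (b2 * q3) - b2 * (k - b3) * q2.
  by rewrite [t * _]mulrCA r3; ring.
have -> : forall u,
    q0 + (- 1 - b2 * b3 / u) * q2 - (1 + (- 1 - b2 * b3 / u)) * q4 =
    q0 - q2 - (b2 * b3 * q2 - b2 * (b3 * q4)) / u by move=> u; ring.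
rewrite e4 e3 e2 e1; field.
by rewrite s0 k1 k0.
Qed.

(** * Modules of endpoint two *)

Section EndpointTwo.
Variables (R : realType) (X : finType) (e : rel X) (p : nat -> nat -> nat -> nat).
Hypotheses (Ge : connected_graph e) (Re : distance_regular e p).
Hypotheses (Be : bipartite e) (D_ge4 : (4 <= diameter e)%N).
Variables (x : X) (W : {vspace 'cV[R[i]]_#|X|}) (v : 'cV[R[i]]_#|X|).
Hypotheses (TW : Tmodule e x W) (W2 : has_endpoint e x W 2).
Hypothesis Wv : v \in dual_part e x 2 W.

Notation A := (distance_mx R e 1).
Notation Es j := (dual_idempotent R e x j).
Notation d a b := (dist e (enum_val a) (enum_val b)).

Let D_gt0 : (0 < diameter e)%N. Proof. exact: leq_trans D_ge4. Qed.

Lemma dual_idempotent_col j (u : 'cV[R[i]]_#|X|) a :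
  (Es j *m u) a 0 = if dist e x (enum_val a) == j then u a 0 else 0.
Proof. by rewrite mul_diag_mx !mxE; case: eqP; rewrite ?mul1r ?mul0r. Qed.

Lemma module_closed (B : 'M[R[i]]_#|X|) u :
  terwilliger e x B -> u \in W -> B *m u \in W.
Proof.
move=> TB Wu; have /subvP := TW TB; apply.
by have := memv_img (mxop B) Wu; rewrite lfunE.
Qed.

Lemma endpoint_support a : dist e x (enum_val a) != 2 -> v a 0 = 0.
Proof.
have /memv_imgP [u _ ->] := Wv; rewrite lfunE /= dual_idempotent_col.
by case: eqP.
Qed.

Lemma endpoint_vector_in_module : v \in W.
Proof.
have /memv_imgP [u Wu ->] := Wv; rewrite lfunE /=.
by apply: module_closed => //; constructor; apply: leq_trans D_ge4.
Qed.

(** The entry of A^2 v at x is c_2 times the sum of the entries of v, and it is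
    0 because A^2 v belongs to W and W has no component at x; moreover
    c_2 <> 0. *)
Lemma endpoint_sum_eq0 : \sum_b v b 0 = 0.
Proof.
have WAAv : A *m (A *m v) \in W.
  do 2!(apply: module_closed; first exact: terwilliger_adj).
  exact: endpoint_vector_in_module.
have E0 : (Es 0 *m (A *m (A *m v))) = 0.
  have := memv_img (mxop (Es 0)) WAAv.
  by rewrite -[(_ @: _)%VS]/(dual_part e x 0 W) W2.2 // memv0 lfunE /= => /eqP.
have := dual_idempotent_col 0 (A *m (A *m v)) (enum_rank x).
rewrite E0 enum_rankK mxE (_ : dist e x x = 0%N) ?eqxx; last first.
  by apply/eqP; rewrite dist_eq0.
pose delta0 h : R[i] := (h == 0%N)%:R.
have one a b : (1%:M : 'M[R[i]]_#|X|) a b = delta0 (d a b).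
  by rewrite mxE /delta0 dist_eq0 // (inj_eq enum_val_inj).
have A1 := @mul_adjacency_distance X e p Ge Re Be D_gt0 R.
rewrite mulmxA -[A in _ *m A *m v]mulmx1 mxE.
rewrite (eq_bigr (fun b => ((bnum p 0)%:R - (bnum p 2)%:R) * v b 0)); last first.
  move=> b _; have [d2|] := eqVneq (dist e x (enum_val b)) 2; last first.
      by move/endpoint_support => ->; rewrite !mulr0.
  rewrite (A1 _ _ (A1 _ _ one)) enum_rankK d2; congr (_ * _).
  by have [_ ->] := walk_counts R Ge Re Be D_ge4.
rewrite -mulr_sumr => /eqP; rewrite eq_sym mulf_eq0 subr_eq0 eqr_nat.
case/orP => [/eqP eq_k|/eqP //].
have := up_lt (h := 2) Ge Re D_gt0 (leq_trans (isT : 1 < 4)%N D_ge4).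
by rewrite /up (leq_trans (isT : 2 < 4)%N D_ge4) eq_k ltnn.
Qed.

Lemma local_eigenvector (eta : R[i]) a : local_eigenvalue e x W eta ->
  dist e x (enum_val a) = 2 ->
  \sum_b (d a b == 2)%:R * v b 0 = eta * v a 0.
Proof.
move=> /subvP /(_ _ Wv); rewrite mem_eigenspace => /eqP /matrixP /(_ a 0) + d2.
rewrite -!mulmxA dual_idempotent_col d2 eqxx !mxE => <-.
apply: eq_bigr => b _; rewrite mxE dual_idempotent_col; congr (_ * _).
by have [//|/endpoint_support ->] := eqVneq.
Qed.

(** Vertices at distance 2 from x are at distance 0, 2 or 4 from each other, and
    q(dist) = q(4) + (q(0) - q(4)) [dist = 0] + (q(2) - q(4)) [dist = 2] there;
    the first term contributes q(4) times the sum of the entries of v, that is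
    0. *)
Lemma class_constant_mul_endpoint (eta : R[i]) (P : 'M[R[i]]_#|X|) q a :
  local_eigenvalue e x W eta -> (forall a b, P a b = q (d a b)) ->
  dist e x (enum_val a) = 2 ->
  (P *m v) a 0 = (q 0%N + eta * q 2 - (1 + eta) * q 4) * v a 0.
Proof.
move=> Weta Pq a2; rewrite mxE.
transitivity (\sum_b (q 4 * v b 0 + (q 0%N - q 4) * ((b == a)%:R * v b 0)
                      + (q 2 - q 4) * ((d a b == 2)%:R * v b 0))).
  apply: eq_bigr => b _.
  have [b2|/endpoint_support ->] := eqVneq (dist e x (enum_val b)) 2; last first.
    by rewrite !mulr0 !addr0.
  have := dist_triangle Ge (enum_val a) x (enum_val b).
  rewrite (distC Ge _ x) a2 b2 Pq => le4.
  have even_ab : ~~ odd (d a b).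
    have [Y oddY] := odd_dist Ge Be.
    rewrite oddY -(addbK (Y x) (Y (enum_val a))) -addbA -!oddY.
    by rewrite (distC Ge _ x) a2 b2.
  have ab0 : (d a b == 0%N) = (b == a).
    by rewrite dist_eq0 // (inj_eq enum_val_inj) eq_sym.
  rewrite -ab0; move: (d a b) le4 even_ab => [|[|[|[|[|?]]]]] //= _ _; ring.
rewrite !big_split -!mulr_sumr endpoint_sum_eq0 (local_eigenvector Weta a2).
rewrite (bigD1 a) //= eqxx mul1r big1 ?addr0 => [|b /negPf ->]; last by rewrite mul0r.
ring.
Qed.

End EndpointTwo.

Theorem theorem13p2 (R : realType) (X : finType) (e : rel X) (D : nat)
    (p : nat -> nat -> nat -> nat) (theta : nat -> R)
    (E : nat -> 'M[R[i]]_#|X|) (x : X) (n : nat)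
    (W : {vspace 'cV[R[i]]_#|X|}) (v : 'cV[R[i]]_#|X|)
    (k := bnum p 0) (d := D./2)
    (m := fun i : nat => \rank (E i)) :
  connected_graph e ->
  distance_regular e p ->
  bipartite e ->
  diameter e = D ->
  (4 <= D)%N ->
  (3 <= k)%N ->
  ordered_eigenvalues (distance_mx R e 1) D theta ->
  (forall i : nat, (i <= D)%N ->
     orthogonal_projection (E i)
       (passmx.leigenspace (mxop (distance_mx R e 1)) (theta i)%:C)) ->
  n \in (if odd D then [:: 1%N; d] else [:: 1%N]) ->
  irreducible_Tmodule e x W ->
  thin e x W ->
  has_endpoint e x W 2 ->
  local_eigenvalue e x W
    (- 1 - (bnum p 2)%:R * (bnum p 3)%:R
             / (theta n ^+ 2 - (bnum p 2)%:R))%:C ->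
  v != 0 ->
  v \in dual_part e x 2 W ->
  let index i := [&& (1 <= i)%N, (i <= D - 1)%N, i != n & i != (D - n)%N] in
  let den : R := #|X|%:R * k%:R * (bnum p 1)%:R
                   * (theta n ^+ 2 - (bnum p 2)%:R) in
  [/\ forall i j : nat, index i -> index j -> i <> j ->
        hdot (E i *m v) (E j *m v) = 0,
      den != 0 &
      forall i : nat, index i ->
        hdot (E i *m v) (E i *m v) =
        ((m i)%:R * (theta i ^+ 2 - k%:R ^+ 2) * (theta i ^+ 2 - theta n ^+ 2)
           / den)%:C * hdot v v].
Proof.
move=> Ge Re Be eD D_ge4 k_ge3 eig hE n_in [TW _ _] _ W2 Weta v_neq0 Wv index den.
subst D; have n_or : n = 1%N \/ odd (diameter e) /\ n = d.
  by move: n_in; case: odd; rewrite !inE; [case/orP|] => /eqP ->; [left|right|left].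
have sb_neq0 : theta n ^+ 2 - (bnum p 2)%:R != 0.
  rewrite subr_eq0.
  exact: (square_theta_neq_b2 Ge Re Be D_ge4 eig n_or).
have D_gt0 : (0 < diameter e)%N := leq_trans (isT : 0 < 4)%N D_ge4.
have X_gt0 : (0 < #|X|)%N by apply/card_gt0P; exists x.
have b1E : (bnum p 1)%:R = k%:R - 1 :> R.
  have D_gt1 := leq_trans (isT : 1 < 4)%N D_ge4.
  have := up1 Ge Re Be D_gt0 D_gt1; rewrite /up D_gt1 -/k => ->.
  by rewrite -subn1 natrB // (leq_trans _ k_ge3).
have k_neq0 : k%:R != 0 :> R by rewrite pnatr_eq0 -lt0n (leq_trans _ k_ge3).
have k1_neq0 : k%:R - 1 != 0 :> R.
  by rewrite subr_eq0 (eqr_nat R k 1) gtn_eqF // (leq_trans _ k_ge3).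
have X_neq0 : #|X|%:R != 0 :> R by rewrite pnatr_eq0 -lt0n.
have den_neq0 : den != 0 by rewrite /den b1E !mulf_neq0.
have le_index i : index i -> (i <= diameter e)%N by case/and4P => _ ? _ _; lia.
have eigE i : (i <= diameter e)%N ->
    distance_mx R e 1 *m (E i *m v) = (theta i)%:C *: (E i *m v).
  by move=> le_i; apply/eqP; rewrite -mem_eigenspace; case: (hE i le_i v).
split=> // [i j /le_index le_i /le_index le_j neq_ij|i /le_index le_i].
  apply: orthogonal_eigenvectors (eigE i le_i) (eigE j le_j).
    exact: adjacency_real_symmetric.
  case: (ltngtP i j) => // lt; last by rewrite lt_eqF // eig.1.
  by rewrite gt_eqF // eig.1.
have [q Eq] := eigenprojection_class_constant Ge Re Be D_ge4 eig le_i (hE i le_i).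
have [mq r0 r1 r2 r3] := eigenprojection_recurrence Ge Re Be D_ge4 le_i (hE i le_i) Eq.
set val := _ / den.
have toC := (rmorphM, rmorphB, rmorphN, rmorphXn, rmorph_nat, rmorph1, fmorphV).
have inC (t : R) : t != 0 -> t%:C != 0 by rewrite fmorph_eq0.
have Ev a : dist e x (enum_val a) = 2 -> (E i *m v) a 0 = val%:C * v a 0.
  move=> a2.
  rewrite (class_constant_mul_endpoint Ge Re Be D_ge4 TW W2 Wv Weta Eq a2).
  congr (_ * _); move: (inC _ k_neq0) (inC _ k1_neq0) (inC _ sb_neq0) (inC _ X_neq0).
  rewrite /val /den b1E !toC /= => kC k1C sbC XC.
  rewrite (cosine_combination kC k1C sbC r0 r1 r2 r3) /m -mq -/k.
  by field; rewrite XC kC k1C sbC.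
have := (hE i le_i v).2 _ (hE i le_i v).1; rewrite hdotBl => /eqP.
rewrite subr_eq0 => /eqP <-; rewrite !hdotE mulr_sumr; apply: eq_bigr => a _.
have [/Ev ->|/(endpoint_support Wv) ->] := eqVneq (dist e x (enum_val a)) 2.
  by rewrite rmorphM /= oppr0 mulrCA.
by rewrite !mul0r mulr0.
Qed.
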